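(* Let $t_2=\frac{\sqrt5-1}{2}$. (i) For each $t\in(\frac12,t_2)$, the set $A_t$ of points with unique address is $$A_t=\{x_c(t)\ :\ c \text{ is an itinerary and either } t<t^*(c),\ \text{ or } t=t^*(c) \text{ and the orbit of } c \text{ under the doubling map does not contain a kneading sequence of } c\}.$$ (ii) For each itinerary $b=.b_1b_2\dots$, the function $x_b(t)$ represents the $b$-quantile of all Bernoulli convolutions $\nu_t$ with $t\le t^*(b)$: $$F_t(x_b(t))=\nu_t[0,x_b(t)]=b\qquad\text{for } \tfrac12\le t\le t^*(b),\ t<1.$$
   Context: For $t\in[\frac12,1)$ put $f_0(x)=tx$, $f_1(x)=tx+1-t$ on $[0,1]$. The Bernoulli convolution $\nu_t$ is the unique Borel probability measure on $[0,1]$ with $\nu_t(A)=\frac12\nu_t(f_0^{-1}(A))+\frac12\nu_t(f_1^{-1}(A))$ for all Borel sets $A$, and $F_t(x)=\nu_t[0,x]$. A 01-sequence $s=s_1s_2\dots$ is an address of $x$ (for the parameter $t$) if $x=\lim_{k\to\infty}f_{s_1}\cdots f_{s_k}(0)$. $A_t$ is the set of $x\in[0,1]$ with exactly one address. A 01-sequence $b_1b_2\dots$ is identified with the binary number $b=.b_1b_2\dots=\sum_{k\ge1}b_k2^{-k}$, and the doubling map acts as the shift on sequences. $b$ is an itinerary if the closure of its orbit under the doubling map does not contain $\frac12$. An itinerary $b$ is a kneading sequence if no number $.b_kb_{k+1}\dots$, $k\ge1$, is nearer to $\frac12$ than $b$. For a non-constant itinerary $c$, a kneading sequence of $c$ is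 a point of the orbit closure of $c$ with minimal distance to $\frac12$ (there are one or two such points; if two, they are $b$ and $1-b$). The address curve of a 01-sequence $b$ is $x_b(t)=\frac{1-t}{t}\sum_{k=1}^\infty b_kt^k$. For a non-constant kneading sequence $b$ with $b_1=0$, $t^*(b)$ is the unique solution $t\in[0,1]$ of $\sum_{k=1}^\infty b_{k+1}t^k=1$ (equivalently, of $x_b(t)=1-t$). For a kneading sequence $c$ with $c_1=1$ put $t^*(c)=t^*(1-c)$, where $1-c$ is the sequence $1-c_1,1-c_2,\dots$. For a non-constant itinerary $c$ put $t^*(c)=t^*(b)$, where $b$ is a kneading sequence of $c$. For the constant sequences $000\dots$ and $111\dots$ (which are itineraries, fixed by the shift, with values $0$ and $1$), put $t^*=+\infty$. *)

(* Defs.v *)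
From HB Require Import structures.
From mathcomp Require Import all_boot all_order all_algebra.
From mathcomp Require Import all_classical all_reals all_analysis.
Set Implicit Arguments.
Unset Strict Implicit.
Unset Printing Implicit Defensive.
Import Order.TTheory GRing.Theory Num.Theory.
Import numFieldNormedType.Exports.
Local Open Scope classical_set_scope.
Local Open Scope ring_scope.

(* A 01-sequence s_1 s_2 ... is a function s : nat -> bool with s_k = s (k - 1);
   all indices are therefore shifted by one with respect to the usual text. *)
Definition shift01 (k : nat) (s : nat -> bool) : nat -> bool :=
  fun n => s (k + n)%N.

Definition compl01 (s : nat -> bool) : nat -> bool := fun n => ~~ s n.

Definition constant01 (s : nat -> bool) : Prop := forall n, s n = s 0%N.

Section Defs.
Context {R : realType}.
Implicit Types (t x : R) (b c s : nat -> bool).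

Definition ifs t (i : bool) x : R := if i then t * x + 1 - t else t * x.

Definition is_address t s x : Prop :=
  (fun k => foldr (fun j y => ifs t (s j) y) 0 (iota 0 k)) @ \oo --> x.

Definition unique_address t : set R :=
  [set x | 0 <= x <= 1 /\ exists! s, is_address t s x].

(* A Borel probability measure on [0, 1] is represented by a probability
   measure on R giving mass 1 to [0, 1]; the maps f_i have domain [0, 1]. *)
Definition is_bernoulli_convolution t
    (nu : probability (measurableTypeR R) R) : Prop :=
  nu `[0, 1]%classic = 1%E /\
  forall A : set (measurableTypeR R), measurable A -> A `<=` `[0, 1]%classic ->
    nu A = ((2^-1)%:E * nu (`[0%R, 1%R]%classic `&` ifs t false @^-1` A)
            + (2^-1)%:E * nu (`[0%R, 1%R]%classic `&` ifs t true @^-1` A))%E.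

Definition binval b : R :=
  limn (series (fun k => (b k)%:R * 2^-1 ^+ k.+1 : R)).

(* The doubling map acts on sequences as the shift (so that it fixes 111...). *)
Definition orbit01 b : set R := [set binval (shift01 k b) | k in [set: nat]].

Definition itinerary b : Prop := ~ closure (orbit01 b) 2^-1.

(* For an itinerary c, no point of the orbit closure other than 0 and 1 is a
   dyadic rational, so such a point has exactly one binary expansion b. *)
Definition kneading_of c b : Prop :=
  closure (orbit01 c) (binval b) /\
  forall y, closure (orbit01 c) y -> `|binval b - 2^-1| <= `|y - 2^-1|.

Definition address_curve b t : R :=
  (1 - t) / t * limn (series (fun k => (b k)%:R * t ^+ k.+1 : R)).

(* For b_1 = 0: the t in [0, 1] with \sum_(k >= 1) b_(k+1) t^k = 1. *)
Definition tstar0 b : R :=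
  get [set t | 0 <= t <= 1 /\
    series (fun k => (b k.+1)%:R * t ^+ k.+1) @ \oo --> (1 : R)].

Definition tstar_kneading b : R :=
  if b 0%N then tstar0 (compl01 b) else tstar0 b.

(* A non-constant itinerary has one kneading sequence b or two, b and compl01 b;
   tstar_kneading takes the same value on both, so the choice is immaterial. *)
Definition tstar c : \bar R :=
  if `[< constant01 c >] then +oo%E
  else (tstar_kneading (get (kneading_of c)))%:E.

End Defs.

Arguments itinerary R b : clear implicits.
Arguments kneading_of R c b : clear implicits.
Arguments binval R b : clear implicits.
Arguments tstar R c : clear implicits.

(* Main.v *)
(* With value01 t s = \sum_(k >= 1) s_k t^k, a sequence c is the only address of
   x_c(t) iff, for every k, the tail of c starting at c_k, complemented when
   c_k = 1 (orient01 c k), has value < t: this says that no image of x_c(t) under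
   the expanding maps lies in the overlap [1 - t, t].  A kneading sequence, oriented
   in the same way, is the largest oriented tail in the closure of the orbit, so by
   Parry's comparison argument all oriented tails have value <= t as soon as this
   one does, that is for t <= t^*(c), with equality only for the kneading
   sequence itself.  For (ii), once the oriented tails have value <= t, the numbers
   nu [0, x_(shift^k b)(t)] satisfy the recursion of the binary values of the
   shifts of b; the differences at least double at each step and are bounded,
   hence vanish. *)
Require Import Defs.
From HB Require Import structures.
From mathcomp Require Import all_boot all_order all_algebra.
From mathcomp Require Import all_classical all_reals all_analysis.
From mathcomp Require Import ring lra zify.
Import Order.TTheory GRing.Theory Num.Theory.
Import numFieldNormedType.Exports.
Local Open Scope classical_set_scope.
Local Open Scope ring_scope.
Set Implicit Arguments.
Unset Strict Implicit.

(** * Shifts and complements of 01-sequences *)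

Definition flip01 (e : bool) (s : nat -> bool) : nat -> bool :=
  fun n => e (+) s n.

Lemma flip01K e : involutive (flip01 e).
Proof. by move=> s; apply/funext => n; rewrite /flip01 addKb. Qed.

Lemma flip01F s : flip01 false s = s.
Proof. by apply/funext. Qed.

Lemma shift01D m n s : shift01 m (shift01 n s) = shift01 (n + m) s.
Proof. by apply/funext => i; rewrite /shift01 addnA. Qed.

Lemma seq01_diff (s s' : nat -> bool) : s <> s' ->
  exists2 n, (forall i, (i < n)%N -> s i = s' i) & s n != s' n.
Proof.
move=> ne; have ex : exists n, s n != s' n.
  apply/not_existsP => H; apply: ne; apply/funext => n.
  by apply/eqP/negPn/negP/H.
case: (ex_minnP ex) => n nn min; exists n => // i lin.
by apply/eqP/negPn/negP => /min; rewrite leqNgt lin.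
Qed.

(** * Power series with 0-1 coefficients *)

Section Series01.
Context {R : realType}.
Implicit Types (t x q : R) (s b c d w : nat -> bool) (e : bool).

(** Boundedness gives a finite supremum [S], which inherits [S <= a + q * S]. With [a = 0] this
    replaces an iterated estimate along the tails of a sequence. *)
Lemma contraction_bound (f : nat -> R) (a q M : R) : 0 <= q -> q < 1 ->
  (forall n, f n <= M) -> (forall n, exists m, f n <= a + q * f m) ->
  forall n, f n <= a / (1 - q).
Proof.
move=> q0 q1 fM fq n.
have hs : has_sup (range f) by split; [exists (f 0%N), 0%N | exists M => _ [k _ <-]].
have fsup k : f k <= sup (range f) by apply: sup_upper_bound => //; exists k.
have : sup (range f) <= a + q * sup (range f).
  apply: ge_sup => [|_ [k _ <-]]; first by case: hs.
  have [m /le_trans] := fq k; apply; by rewrite lerD2l ler_wpM2l.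
rewrite ler_pdivlMr ?subr_gt0// => H.
apply: (@le_trans _ _ (sup (range f) * (1 - q))); last by lra.
by apply: ler_wpM2r (fsup n); rewrite subr_ge0 ltW.
Qed.

Lemma expr_lt_eps q (eps : R) : 0 <= q -> q < 1 -> 0 < eps ->
  exists N, q ^+ N < eps.
Proof.
move=> q0 q1 eps0; have q1' : `|q| < 1 by rewrite ger0_norm.
have /cvgrPdist_lt/(_ eps eps0)[N _ /(_ N (leqnn N))] := cvg_expr q1'.
by rewrite sub0r normrN ger0_norm ?exprn_ge0// => qN; exists N.
Qed.

Definition term01 s t : nat -> R := fun k => (s k)%:R * t ^+ k.+1.

Definition value01 t s : R := limn (series (term01 s t)).

Lemma term01_ge0 s t k : 0 <= t -> 0 <= term01 s t k.
Proof. by move=> t0; rewrite mulr_ge0// exprn_ge0. Qed.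

Lemma nondecreasing_series01 s t : 0 <= t ->
  nondecreasing_seq (series (term01 s t)).
Proof. by move=> t0; apply: nondecreasing_series => i _ _; exact: term01_ge0. Qed.

Lemma is_cvg_series01 s t : 0 <= t -> t < 1 -> cvgn (series (term01 s t)).
Proof.
move=> t0 t1; apply: (@series_le_cvg _ _ (geometric t t)).
- by move=> n; exact: term01_ge0.
- by move=> n; rewrite /= mulr_ge0// exprn_ge0.
- move=> n; rewrite /= -exprS /term01; case: (s n); rewrite ?mul1r ?mul0r//.
  by rewrite exprn_ge0.
- by apply: is_cvg_geometric_series; rewrite ger0_norm.
Qed.

Lemma series01_le s t l n : 0 <= t -> series (term01 s t) @ \oo --> l ->
  series (term01 s t) n <= l.
Proof.
move=> t0 cl; rewrite -(cvg_lim _ cl)//.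
by apply: nondecreasing_cvgn_le; [exact: nondecreasing_series01 | apply/cvg_ex; exists l].
Qed.

(** The term of a digit 1 grows strictly and no other term decreases. Limits are hypotheses here,
    since [u] may be 1, where convergence is not automatic. *)
Lemma series01_lt_value s t u l l' j : 0 <= t -> t < u -> s j ->
  series (term01 s t) @ \oo --> l -> series (term01 s u) @ \oo --> l' -> l < l'.
Proof.
move=> t0 tu sj cl cl'; have u0 : 0 <= u by rewrite (le_trans t0)// ltW.
suff : l + (u ^+ j.+1 - t ^+ j.+1) <= l'.
  by apply: lt_le_trans; rewrite ltrDl subr_gt0 ltrXn2r.
rewrite -lerBrDr -(cvg_lim _ cl)//; apply: limr_le; first by apply/cvg_ex; exists l.
near=> n; rewrite lerBrDr; apply: le_trans _ (series01_le n u0 cl').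
have jn : (j < n)%N by near: n; exists j.+1.
rewrite /series/= (bigD1_seq j) ?mem_index_iota ?iota_uniq//=.
rewrite [leRHS](bigD1_seq j) ?mem_index_iota ?iota_uniq//=.
rewrite {1 3}/term01 sj !mul1r addrAC addrCA subrr addr0 lerD2l.
apply: ler_sum => i _; rewrite /term01 ler_wpM2l// lerXn2r// ltW//.
Unshelve. all: by end_near.
Qed.

Lemma value01_split t s n : 0 <= t -> t < 1 ->
  value01 t s = series (term01 s t) n + t ^+ n * value01 t (shift01 n s).
Proof.
move=> t0 t1; apply/cvg_lim => //; rewrite -(cvg_shiftn n)/=.
have -> : (fun k => series (term01 s t) (k + n)%N) =
    (fun k => series (term01 s t) n + t ^+ n * series (term01 (shift01 n s) t) k).
  apply/funext => k; rewrite /series/= addnC (@big_cat_nat _ _ _ n) ?leq_addr//=.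
  congr (_ + _); rewrite -{1}[n]add0n big_addn addnC addnK mulr_sumr.
  by apply: eq_bigr => i _; rewrite /term01 /shift01 addnC mulrCA -exprD addnS.
apply: cvgD; first exact: cvg_cst.
by apply: cvgMr; exact: is_cvg_series01.
Qed.

Lemma series01_1 t s : series (term01 s t) 1%N = (s 0%N)%:R * t.
Proof. by rewrite /series/= big_nat1. Qed.

Lemma value01_rec t s : 0 <= t -> t < 1 ->
  value01 t s = t * ((s 0%N)%:R + value01 t (shift01 1 s)).
Proof.
by move=> t0 t1; rewrite (value01_split s 1)// series01_1 expr1 mulrDr [t * _%:R]mulrC.
Qed.

Lemma value01_ge0 t s : 0 <= t -> t < 1 -> 0 <= value01 t s.
Proof.
move=> t0 t1; have := series01_le 0 t0 (is_cvg_series01 (s := s) t0 t1).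
by rewrite /series/= big_geq.
Qed.

Lemma value01_compl t s : 0 <= t -> t < 1 ->
  value01 t s + value01 t (flip01 true s) = t / (1 - t).
Proof.
move=> t0 t1; rewrite /value01 -lim_seriesD; [|exact: is_cvg_series01..].
apply/cvg_lim => //; have := @cvg_geometric_series R t t.
rewrite ger0_norm// => /(_ t1).
suff -> : geometric t t = term01 s t + term01 (flip01 true s) t by [].
apply/funext => k; rewrite /= -exprS -[RHS]/(term01 s t k + term01 _ t k) /term01 /flip01.
by case: (s k); rewrite /= ?mul1r ?mul0r ?addr0 ?add0r.
Qed.

Lemma value01_le t s : 0 <= t -> t < 1 -> value01 t s <= t / (1 - t).
Proof.
by move=> t0 t1; rewrite -(value01_compl s t0)// lerDl value01_ge0.
Qed.

Lemma eq_series01 t s s' n : (forall i, (i < n)%N -> s i = s' i) ->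
  series (term01 s t) n = series (term01 s' t) n.
Proof.
by move=> ss'; apply: eq_big_nat => i /andP[_ /ss' E]; rewrite /term01 E.
Qed.

Lemma value01_ones_ge t s n : 0 <= t -> t < 1 -> (forall i, (i < n)%N -> s i) ->
  t - t ^+ n.+1 <= (1 - t) * value01 t s.
Proof.
move=> t0 t1 sn.
have <- : (1 - t) * series (term01 s t) n = t - t ^+ n.+1.
  rewrite (@eq_series01 t s (fun _ => true)); last by move=> i /sn.
  elim: n {sn} => [|n IH]; first by rewrite /series/= big_geq// expr1; ring.
  by rewrite seriesSr mulrDr IH /term01 mul1r [t ^+ n.+2]exprS; ring.
apply: ler_wpM2l; first by rewrite subr_ge0 ltW.
exact: series01_le t0 (is_cvg_series01 t0 t1).
Qed.

Lemma value01_flip_eq t s s' e : 0 <= t -> t < 1 ->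
  value01 t s = value01 t s' -> value01 t (flip01 e s) = value01 t (flip01 e s').
Proof.
move=> t0 t1; case: e; rewrite ?flip01F// => E.
by have := value01_compl s t0 t1; rewrite -(value01_compl s' t0)// E => /addrI.
Qed.

(** Removing one digit turns the difference of the two values into [(t - u)] times a factor at most
    [1 / (1 - r)], plus [u] times the difference for the next tail. Contraction with ratio [r]
    supplies the second factor [1 / (1 - r)]. *)
Lemma value01_lipschitz t u r s : 0 <= t -> t <= r -> 0 <= u -> u <= r -> r < 1 ->
  `|value01 t s - value01 u s| <= `|t - u| / (1 - r) ^+ 2.
Proof.
move=> t0 tr u0 ur r1.
have t1 := le_lt_trans tr r1; have u1 := le_lt_trans ur r1.
have bd v s' : 0 <= v -> v <= r -> value01 v s' <= r / (1 - r).
  move=> v0 vr; apply: le_trans (value01_le s' v0 (le_lt_trans vr r1)) _.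
  have v1 := le_lt_trans vr r1.
  by rewrite ler_pM ?invr_ge0 ?subr_ge0 ?lef_pV2 ?posrE ?subr_gt0 ?(ltW v1)// lerD2l lerN2.
pose f n := `|value01 t (shift01 n s) - value01 u (shift01 n s)|.
have r'0 : 0 < 1 - r by rewrite subr_gt0.
rewrite -[s in value01 t s]/(shift01 0 s) -[s in value01 u s]/(shift01 0 s) expr2 invfM mulrA.
apply: (@contraction_bound f _ _ (r / (1 - r))); rewrite ?(le_trans t0)//.
  move=> n; rewrite /f ler_norml.
  have := value01_ge0 (shift01 n s) t0 t1; have := bd t (shift01 n s) t0 tr.
  have := value01_ge0 (shift01 n s) u0 u1; have := bd u (shift01 n s) u0 ur.
  lra.
move=> n; exists n.+1; rewrite /f (value01_rec _ t0)// (value01_rec _ u0)// shift01D addn1.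
set A := value01 t _; set B := value01 u _;
set y := (shift01 n s 0%N)%:R.
have -> : t * (y + A) - u * (y + B) = (t - u) * (y + A) + u * (A - B) by ring.
apply: le_trans (ler_normD _ _) _; rewrite !normrM (ger0_norm u0) lerD ?ler_wpM2r//.
apply: ler_wpM2l => //.
have A0 : 0 <= A by exact: value01_ge0.
have y0 : 0 <= y <= 1 by rewrite /y; case: (shift01 _ _ _); rewrite /= ?lexx ler01.
rewrite ger0_norm; last by rewrite addr_ge0//; case/andP: y0.
have -> : (1 - r)^-1 = 1 + r / (1 - r) by field; rewrite gt_eqF.
by apply: lerD; [case/andP: y0 | exact: bd].
Qed.

Lemma address_curveE t s : address_curve s t = (1 - t) / t * value01 t s.
Proof. by []. Qed.

Lemma address_curve_rec t s : 0 < t -> t < 1 ->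
  address_curve s t = ifs t (s 0%N) (address_curve (shift01 1 s) t).
Proof.
move=> t0 t1; rewrite !address_curveE value01_rec// ?ltW// /ifs.
by case: (s 0%N) => /=; field; rewrite gt_eqF.
Qed.

Lemma address_curve_itv t s : 0 < t -> t < 1 -> 0 <= address_curve s t <= 1.
Proof.
move=> t0 t1; rewrite address_curveE.
have v0 := value01_ge0 s (ltW t0) t1; have v1 := value01_le s (ltW t0) t1.
have p0 : 0 < (1 - t) / t by rewrite divr_gt0// subr_gt0.
apply/andP; split; first by rewrite mulr_ge0// ltW.
apply: (@le_trans _ _ ((1 - t) / t * (t / (1 - t)))); first by rewrite ler_wpM2l// ltW.
by rewrite mulrA divfK ?gt_eqF// divff// gt_eqF// subr_gt0.
Qed.

Lemma is_addressP t s x : 0 < t -> t < 1 ->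
  is_address t s x <-> x = address_curve s t.
Proof.
move=> t0 t1.
(* A finite composition of the maps is a scaled partial sum; the starting index [m] is free because
   the induction peels off the outermost map. *)
have E k m : foldr (fun j y => ifs t (s j) y) 0 (iota m k) =
    (1 - t) / t * series (term01 (shift01 m s) t) k.
  elim: k m => [|k IH] m /=; first by rewrite /series/= big_geq// mulr0.
  rewrite IH [in RHS]/series/= big_nat_recl//= /term01 /shift01 addn0 expr1 /ifs.
  have -> : \sum_(0 <= i < k) ((s (m + i.+1)%N)%:R * t ^+ i.+2) =
     t * series (term01 (shift01 m.+1 s) t) k.
    rewrite /series/= mulr_sumr; apply: eq_bigr => i _.
    by rewrite /term01 /shift01 addSnnS [t ^+ i.+2]exprS mulrCA.
  by case: (s m) => /=; field; rewrite gt_eqF.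
have c : (fun k => foldr (fun j y => ifs t (s j) y) 0 (iota 0 k)) @ \oo -->
    address_curve s t.
  under eq_fun do rewrite E.
  by apply: cvgMr; exact: is_cvg_series01 (ltW t0) t1.
split=> [cx|->//]; exact: cvg_unique cx c.
Qed.

(** Greedy expansion: the digit is 1 whenever the point lies in the image of [ifs t true]. For
    [t >= 1/2] the two images cover the unit interval, so the orbit [X] stays inside it. *)
Lemma address_exists t x : 2^-1 <= t -> t < 1 -> 0 <= x <= 1 ->
  exists s, address_curve s t = x.
Proof.
move=> t2 t1 x01; have t0 : 0 < t by lra.
pose digit (y : R) := 1 - t <= y.
pose step (y : R) := if digit y then (y - 1 + t) / t else y / t.
pose X n := iter n step x.
have X01 n : 0 <= X n <= 1.
  elim: n => [//|n]; rewrite /X iterS -/(X n) /step /digit.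
  case: (leP (1 - t) (X n)) => ?; rewrite ler_pdivlMr ?ler_pdivrMr//; lra.
have Xs n : X n = ifs t (digit (X n)) (X n.+1).
  rewrite /X iterS -/(X n) /ifs /step; case: (digit _); field; by rewrite gt_eqF.
exists (fun n => digit (X n)).
pose s n := digit (X n); rewrite -[fun _ => _]/(shift01 0 s) -[x]/(X 0%N).
(* The distance between the tail's point and [X n] is [t] times the next distance, and all are at
   most 1, so they vanish. *)
pose f n := `|address_curve (shift01 n s) t - X n|.
have := @contraction_bound f 0 t 1 (ltW t0) t1 _ _ 0%N.
rewrite mul0r /f => H; apply/eqP; rewrite -subr_eq0 -normr_le0; apply: H => n.
  have := address_curve_itv (shift01 n s) t0 t1; have := X01 n.
  rewrite ler_norml; lra.
exists n.+1; rewrite add0r -{2}(gtr0_norm t0) -normrM.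
suff -> : address_curve (shift01 n s) t - X n =
  t * (address_curve (shift01 n.+1 s) t - X n.+1) by [].
rewrite address_curve_rec// shift01D addn1 (Xs n) /shift01 addn0 -/(s n) /ifs.
by case: (s n); ring.
Qed.

Lemma value01_surj t v : 2^-1 <= t -> t < 1 -> 0 <= v <= t / (1 - t) ->
  exists s, value01 t s = v.
Proof.
move=> t2 t1 /andP[v0 v1]; have t0 : 0 < t by lra.
have t1' : 0 < 1 - t by lra.
have [|s] := @address_exists t ((1 - t) / t * v) t2 t1.
  apply/andP; split; first by rewrite mulr_ge0// divr_ge0// ltW.
  by rewrite mulrAC ler_pdivrMr// mul1r mulrC -ler_pdivlMr.
rewrite address_curveE => /mulfI E; exists s; apply: E.
by rewrite mulf_neq0// ?invr_neq0 ?gt_eqF.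
Qed.

End Series01.

(** * Unique addresses *)

Section UniqueAddress.
Context {R : realType}.
Implicit Types (t x : R) (s b c d w : nat -> bool) (e : bool).

Definition orient01 s k : nat -> bool := flip01 (s k) (shift01 k s).

Lemma orient01_0 s k : orient01 s k 0%N = false.
Proof. by rewrite /orient01 /flip01 /shift01 addn0 addbb. Qed.

(** Oriented tails are stable under cutting in front of a digit 0, which lets the comparison
    arguments recur. *)
Lemma shift01_orient s k n : orient01 s k n = false ->
  shift01 n (orient01 s k) = orient01 s (k + n).
Proof.
rewrite /orient01 /flip01 /shift01 => E; apply/funext => i; rewrite addnA.
by have -> : s k = s (k + n)%N by move: E; case: (s k); case: (s _).
Qed.

Lemma orient01_flip_shift s e k n :
  orient01 (flip01 e (shift01 k s)) n = orient01 s (k + n).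
Proof.
apply/funext => i; rewrite /orient01 /flip01 /shift01 addnA.
by case: e; case: (s (k + n)%N); case: (s _).
Qed.

Lemma unique_addressP t x : 2^-1 <= t -> t < 1 ->
  unique_address t x <->
  exists2 s, x = address_curve s t & forall k, value01 t (orient01 s k) < t.
Proof.
move=> t2 t1; have t0 : 0 < t by lra.
have t0' := ltW t0.
have inj s s' : address_curve s t = address_curve s' t -> value01 t s = value01 t s'.
  by apply: mulfI; rewrite mulf_neq0 ?invr_neq0// lt0r_neq0// subr_gt0.
split=> [[x01 [s [/is_addressP-/(_ t0 t1) xs us]]]|[s xs sP]].
  exists s => // k; rewrite ltNge; apply/negP => tle.
  pose v := value01 t (shift01 1 (orient01 s k)).
  have vE : value01 t (orient01 s k) = t * v.
    by rewrite value01_rec// orient01_0 add0r.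
  have v1 : 1 <= v by rewrite -(ler_pM2l t0) mulr1 -vE.
  have [|u uE] := @value01_surj R t (v - 1) t2 t1.
    have := value01_le (shift01 1 (orient01 s k)) t0' t1; rewrite -/v; lra.
  (* A value >= t is also attained by a sequence starting with 1. *)
  pose w n := if n is n'.+1 then u n' else true.
  have wE : value01 t w = value01 t (orient01 s k).
    by rewrite value01_rec// -[shift01 1 w]/u uE vE /= addrC subrK.
  pose s' n := if (n < k)%N then s n else s k (+) w (n - k)%N.
  have s's : shift01 k s' = flip01 (s k) w.
    apply/funext => i; rewrite /shift01 /s' ltnNge leq_addr/=.
    by rewrite addnC addnK.
  have : s = s'.
    apply: us; apply/is_addressP => //; rewrite xs !address_curveE; congr (_ * _).
    rewrite (value01_split s k)// (value01_split s' k)// s's; congr (_ + _ * _).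
      by apply: eq_series01 => i ik; rewrite /s' ik.
    by rewrite -(flip01K (s k) (shift01 k s)); apply: value01_flip_eq.
  move=> /(congr1 (@^~ k)); rewrite /s' ltnn subnn /=.
  by case: (s k).
split; first by rewrite xs; exact: address_curve_itv.
exists s; split; first exact/is_addressP.
(* At the first disagreement, orienting by [s n] makes the rest of [s] start with 0 and that of [s']
   with 1. The latter has value at least [t], against the bound on [s]. *)
move=> s' /is_addressP-/(_ t0 t1); rewrite xs => /inj ss'; apply: contrapT => ne.
have [n eqn nen] := seq01_diff ne.
move: ss'; rewrite (value01_split s n)// (value01_split s' n)//.
rewrite (eq_series01 _ eqn) => /addrI/mulfI; rewrite expf_neq0 ?gt_eqF// => /(_ isT).
move=> /(value01_flip_eq (s n) t0' t1) E.
have := sP n; rewrite ltNge => /negP; apply.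
rewrite /orient01 E value01_rec// ler_peMr// /flip01 /shift01 addn0.
have -> : s n (+) s' n = true by move: nen; case: (s n); case: (s' n).
by rewrite lerDl value01_ge0.
Qed.

End UniqueAddress.

(** * Itineraries *)

Section Itineraries.
Context {R : realType}.
Implicit Types (t x : R) (s b c d w : nat -> bool) (e : bool).

Let h : R := 2^-1.
Let h0 : 0 <= h. Proof. by rewrite /h invr_ge0. Qed.
Let h1 : h < 1. Proof. by rewrite /h; lra. Qed.
Let hh : h / (1 - h) = 1.
Proof.
have -> : 1 - h = h by rewrite /h; lra.
by rewrite divff// invr_eq0 pnatr_eq0.
Qed.

Lemma binvalE s : binval R s = value01 2^-1 s.
Proof. by []. Qed.

Lemma binval_itv s : 0 <= binval R s <= 1.
Proof.
rewrite binvalE value01_ge0//=; by apply: le_trans (value01_le s h0 h1) _; rewrite hh.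
Qed.

Lemma binval_flip s : binval R (flip01 true s) = 1 - binval R s.
Proof.
have := value01_compl s h0 h1; rewrite hh !binvalE -/h => E.
lra.
Qed.

Lemma binval_flipB e s s' :
  `|binval R (flip01 e s) - binval R (flip01 e s')| = `|binval R s - binval R s'|.
Proof.
case: e; rewrite ?flip01F// !binval_flip distrC; congr `|_|; lra.
Qed.

Lemma binval_flip_half e s :
  `|binval R (flip01 e s) - 2^-1| = `|binval R s - 2^-1|.
Proof.
case: e; rewrite ?flip01F// binval_flip distrC; congr `|_|; lra.
Qed.

Lemma binval_rec s :
  binval R s = 2^-1 * ((s 0%N)%:R + binval R (shift01 1 s)).
Proof. by rewrite binvalE value01_rec. Qed.

Lemma binval_le_half s : s 0%N = false -> binval R s <= 2^-1.
Proof.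
move=> E; rewrite binval_rec E add0r; have := binval_itv (shift01 1 s); lra.
Qed.

(** The complement has a digit 1 at place [i], which bounds its value from below. *)
Lemma binval_gap s i : s i = false -> binval R s <= 1 - 2^-1 ^+ i.+1.
Proof.
move=> si; rewrite lerBrDr -lerBrDl -binval_flip binvalE.
have := series01_le (s := flip01 true s) i.+1 h0 (is_cvg_series01 h0 h1).
apply: le_trans; rewrite /series/= big_nat_recr//= {2}/term01 /flip01 si /= mul1r lerDr.
by rewrite sumr_ge0// => j _; apply: term01_ge0.
Qed.

(* Neither [0 1^N] nor [1 0^N] occurs in [s]. *)
Definition avoids01 N s : Prop :=
  forall k, exists2 i, (i < N)%N & orient01 s k i.+1 = false.

Lemma avoids01_flip_shift N s e k :
  avoids01 N s -> avoids01 N (flip01 e (shift01 k s)).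
Proof. by move=> sN j; rewrite orient01_flip_shift; exact: sN. Qed.

(** Lexicographic order becomes a quantitative gap: after its 0 at place [n], the smaller sequence
    [d] has another 0 within [N] places, so it stays away from the ambiguous expansion 0111... . *)
Lemma binval_separation N d s n : avoids01 N d ->
  (forall i, (i < n)%N -> d i = s i) -> d n = false -> s n = true ->
  binval R d + 2^-1 ^+ (n + N).+1 <= binval R s.
Proof.
move=> dN ds dn sn; rewrite !binvalE.
rewrite (value01_split d n)// (value01_split s n)// (eq_series01 _ ds) -addrA lerD2l.
rewrite -addnS exprD -mulrDr ler_pM2l ?exprn_gt0// ?invr_gt0//.
rewrite (value01_rec (shift01 n s) h0 h1) (value01_rec (shift01 n d) h0 h1).
rewrite !shift01D addn1 /shift01 addn0 dn sn -!/(shift01 _ _) exprS -mulrDr.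
apply: ler_wpM2l => //; rewrite add0r.
have [i iN di] := dN n.
have := @binval_gap (shift01 n.+1 d) i; rewrite binvalE {1}/shift01.
move: di; rewrite /orient01 /flip01 dn /= /shift01 addnS addSn => -> /(_ erefl) vd.
have := value01_ge0 (shift01 n.+1 s) h0 h1.
have : h ^+ N <= h ^+ i.+1 by apply: ler_wiXn2l => //; rewrite ?ltW.
move: vd; rewrite -/h => vd; rewrite -/h /shift01; move: vd; rewrite /shift01.
lra.
Qed.

Lemma binval_close N d s n : avoids01 N d ->
  `|binval R d - binval R s| < 2^-1 ^+ (n + N) -> forall i, (i < n)%N -> d i = s i.
Proof.
move=> dN lt i iltn; apply: contrapT => nei.
have [|m eqm nem] := @seq01_diff d s; first by move=> E; rewrite E in nei.
have mi : (m <= i)%N by rewrite leqNgt; apply/negP => /eqm.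
(* Flipping both sequences by [d m] makes [d] the smaller one at the first difference. *)
move: lt; apply/negP; rewrite -leNgt -(binval_flipB (d m)) distrC.
have dN' : avoids01 N (flip01 (d m) d) := @avoids01_flip_shift N d (d m) 0 dN.
have H : binval R (flip01 (d m) d) + 2^-1 ^+ (m + N).+1 <= binval R (flip01 (d m) s).
  apply: binval_separation dN' _ _ _.
  - by move=> j /eqm E; rewrite /flip01 E.
  - by rewrite /flip01 addbb.
  - by rewrite /flip01; move: nem; case: (d m); case: (s m).
rewrite -lerBrDl in H; apply: le_trans (ler_norm _); apply: le_trans H.
apply: ler_wiXn2l => //; first exact: ltW.
by lia.
Qed.

(** A tail is near 1/2 exactly when it begins with a long block 011...1 or 100...0, so staying away
    from 1/2 bounds the length of these blocks. *)
Lemma itineraryP c : itinerary R c <-> exists N, avoids01 N c.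
Proof.
split=> [ic|[N cN] cl].
  apply: contrapT => /forallNP cN; apply: ic => B /nbhs_ballP[eps /= eps0 epsB].
  have [N Neps] := expr_lt_eps h0 h1 eps0.
  have /existsNP[k kP] := cN N.
  have kT i : (i < N)%N -> orient01 c k i.+1.
    by move=> iN; apply/negPn/negP => /negbTE E; apply: kP; exists i.
  exists (binval R (shift01 k c)); split; first by exists k.
  apply: epsB; rewrite /ball/= distrC -(binval_flip_half (c k)) -/(orient01 c k).
  apply: le_lt_trans Neps; rewrite binval_rec orient01_0 add0r.
  have := @value01_ones_ge R h (shift01 1 (orient01 c k)) N h0 h1 kT.
  rewrite -binvalE exprS => le1; have := binval_itv (shift01 1 (orient01 c k)).
  have := exprn_ge0 N h0; move: le1; rewrite /h => le1.
  by rewrite ler_norml; lra.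
have hN : 0 < h ^+ N.+1 by rewrite exprn_gt0 ?invr_gt0.
have [_ [[k _ <-]]] := cl _ (nbhsx_ballx _ _ hN).
rewrite /ball/= distrC -(binval_flip_half (c k)) -/(orient01 c k) => lt.
have [i iN ci] := cN k; have := @binval_gap (shift01 1 (orient01 c k)) i.
rewrite {1}/shift01 add1n ci => /(_ erefl) vg.
have : h ^+ N <= h ^+ i.+1 by apply: ler_wiXn2l => //; rewrite ltW.
move: lt vg; rewrite binval_rec orient01_0 add0r ltr_norml exprS -/h.
rewrite /h; lra.
Qed.

Lemma closure_orbit01_itv c x : closure (orbit01 c) x -> 0 <= x <= 1.
Proof.
move=> cx; have -> : (0 <= x <= 1) = (x \in `[0, 1]) by rewrite in_itv.
suff : closure (orbit01 c) `<=` [set` `[0 : R, 1]] by apply.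
rewrite [X in _ `<=` X](closure_id _).1; last exact: itv_closed.
by apply: closureS => _ [k _ <-]; rewrite /= in_itv/= binval_itv.
Qed.

(** The orbit closure is compact, so the distance to 1/2 attains its minimum; the minimizer then has
    a binary expansion. *)
Lemma kneading_exists c : exists b, kneading_of R c b.
Proof.
have cpt : compact (closure (orbit01 c : set R)).
  apply: (@subclosed_compact _ _ [set` `[0 : R, 1]]).
  - exact: closed_closure.
  - exact: segment_compact.
  - by move=> x /closure_orbit01_itv; rewrite /= in_itv.
have [||y cy ymin] := @compact_EVT_min R R (fun x => `|x - 2^-1|) _ _ cpt.
- by exists (binval R (shift01 0 c)); apply: subset_closure; exists 0%N.
- apply: continuous_subspaceT => x; apply: cvg_norm; apply: cvgB => //.
  exact: cvg_cst.
have [|b bE] := @value01_surj R h y (lexx _) h1.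
  by rewrite hh (closure_orbit01_itv (set_mem cy)).
exists b; rewrite /kneading_of binvalE bE; split; first exact: set_mem cy.
by move=> z /mem_set /ymin.
Qed.

End Itineraries.

(** * Kneading sequences *)

Section Kneading.
Context {R : realType}.
Implicit Types (t x : R) (s a b c d : nat -> bool) (N k n : nat).

(** Oriented sequences start with 0 and have value at most 1/2, so nearest to 1/2 means largest. *)
Lemma kneading_max c b k : kneading_of R c b ->
  binval R (orient01 c k) <= binval R (orient01 b 0).
Proof.
move=> [_ bmin].
have cl : closure (orbit01 c) (binval R (shift01 k c)).
  by apply: subset_closure; exists k.
have := bmin _ cl; rewrite -(binval_flip_half (c k) (shift01 k c)) -/(orient01 c k).
rewrite -(binval_flip_half (b 0%N) b) -[flip01 _ b]/(orient01 b 0).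
have dle := @binval_le_half R _ (orient01_0 c k).
have ale := @binval_le_half R _ (orient01_0 b 0).
by rewrite !ler0_norm ?subr_le0// lerN2 lerD2r.
Qed.

Lemma orient01_lex c b N k : avoids01 N c -> kneading_of R c b ->
  orient01 c k <> orient01 b 0 ->
  exists n, [/\ forall i, (i < n)%N -> orient01 c k i = orient01 b 0 i,
    orient01 c k n = false & orient01 b 0 n = true].
Proof.
move=> cN bP ne; have [n eqn nen] := seq01_diff ne; exists n.
case dn : (orient01 c k n) nen; case an : (orient01 b 0 n) => // _.
have := kneading_max k bP; rewrite leNgt => /negP; case.
(* After complementing, the tail of [c] becomes the smaller sequence, the one whose avoidance the
   separation lemma requires. *)
have dN : avoids01 N (flip01 true (orient01 c k)).
  exact: (avoids01_flip_shift true 0 (avoids01_flip_shift (c k) k cN)).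
have : binval R (flip01 true (orient01 c k)) + 2^-1 ^+ (n + N).+1 <=
    binval R (flip01 true (orient01 b 0)).
  apply: binval_separation dN _ _ _ => [i /eqn E||]; rewrite /flip01 ?E//.
    by rewrite dn.
  by rewrite an.
have : 0 < (2^-1 : R) ^+ (n + N).+1 by rewrite exprn_gt0// invr_gt0.
rewrite !binval_flip; lra.
Qed.

(** Closeness of binary values forces agreement of digits because [c] avoids long ambiguous
    blocks. *)
Lemma kneading_approx c b N n : avoids01 N c -> kneading_of R c b ->
  exists k, forall i, (i < n)%N -> orient01 c k i = orient01 b 0 i.
Proof.
move=> cN [cl _].
have h0 : 0 < (2^-1 : R) ^+ (n.+1 + N) by rewrite exprn_gt0// invr_gt0.
have [_ [[k _ <-]]] := cl _ (nbhsx_ballx _ _ h0).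
rewrite /ball/= distrC => lt; exists k => i lin.
have kN : avoids01 N (shift01 k c).
  by rewrite -[shift01 k c]flip01F; exact: avoids01_flip_shift.
have E := binval_close kN lt; rewrite /orient01 /flip01 E 1?ltnS 1?ltnW//.
by have := E 0%N isT; rewrite {1}/shift01 addn0 => ->.
Qed.

(** Every finite block of the oriented kneading sequence occurs, up to complement, in [c]. *)
Lemma avoids01_kneading c b N : avoids01 N c -> kneading_of R c b ->
  avoids01 N (orient01 b 0).
Proof.
move=> cN bP k; have [j jE] := kneading_approx (k + N).+1 cN bP.
have [i iN iE] := cN (j + k)%N; exists i => //.
rewrite /orient01 /flip01 in iE *.
have := jE k _; have := jE (k + i.+1)%N _; rewrite /orient01 /flip01 /shift01 => <-; last lia.
move=> <-; last lia.
move: iE; rewrite /shift01 !addnA.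
by case: (c j); case: (c (j + k)%N); case: (c _).
Qed.

(** A change of digit in [c] gives an oriented tail starting with 01, and the kneading sequence
    dominates it. *)
Lemma kneading_orient_1 c b N : ~ constant01 c -> avoids01 N c ->
  kneading_of R c b -> orient01 b 0 1 = true.
Proof.
move=> nc cN bP.
have [k kE] : exists k, c k <> c k.+1.
  apply: contrapT => /forallNP H; apply: nc; elim=> [//|n <-].
  by have /contrapT -> := H n.
have d1 : orient01 c k 1%N = true.
  move: kE; rewrite /orient01 /flip01 /shift01 addn1.
  by case: (c k); case: (c k.+1).
have [<-//|ne] := pselect (orient01 c k = orient01 b 0).
have [[|[|n]] [eqn _]] := orient01_lex cN bP ne; rewrite ?orient01_0//.
by rewrite -(eqn 1%N).
Qed.

(** Avoidance forces another 1 within a bounded distance of each 1. This yields strict comparisons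
    and the existence of the critical parameter. *)
Lemma kneading_orient_infinite c b N m : ~ constant01 c -> avoids01 N c ->
  kneading_of R c b -> exists2 n, (m <= n)%N & orient01 b 0 n = true.
Proof.
move=> nc cN bP; have aN := avoids01_kneading cN bP.
elim: m => [|m [n mn an]]; first by exists 1%N => //; exact: kneading_orient_1 nc cN bP.
have [i iN] := aN n; rewrite {1}/orient01 /flip01 /shift01 an.
case E : (orient01 b 0 (n + i.+1)%N) => // _.
by exists (n + i.+1)%N => //; lia.
Qed.

(* An initial segment on which the two sequences agree cancels,
   the next digit costs [t ^+ n.+1] and the rest of [orient01 c k] is again an
   oriented tail of [c], so the excess over [t] contracts by a factor [t]. *)
Lemma value01_orient_le t c b N k : 0 < t -> t < 1 -> avoids01 N c ->
  kneading_of R c b -> value01 t (orient01 b 0) <= t ->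
  value01 t (orient01 c k) <= t.
Proof.
move=> t0 t1 cN bP ale; have t0' := ltW t0.
(* Truncating the excess at 0 makes it vanish for a tail equal to the kneading sequence, so that
   case fits the same recursion. *)
pose f k := Num.max 0 (value01 t (orient01 c k) - t).
suff : f k <= 0 / (1 - t) by rewrite mul0r /f ge_max lexx/= subr_le0.
apply: (@contraction_bound R f 0 t (t / (1 - t))) => // [n|n].
  have t1' : 0 <= 1 - t by rewrite subr_ge0 ltW.
  rewrite /f ge_max divr_ge0//= lerBlDr.
  by apply: le_trans (value01_le _ t0' t1) _; rewrite lerDl.
have f0 m : 0 <= f m by rewrite /f le_max lexx.
rewrite {1}/f.
have [->|ne] := pselect (orient01 c n = orient01 b 0).
  by exists n; rewrite add0r ge_max mulr_ge0//= (le_trans _ (mulr_ge0 t0' (f0 n)))// subr_le0.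
have [[|m] [eqm dm am]] := orient01_lex cN bP ne; first by rewrite orient01_0 in am.
exists (n + m.+1)%N; rewrite add0r ge_max mulr_ge0//=.
apply: (@le_trans _ _ (t ^+ m.+1 * (value01 t (orient01 c (n + m.+1)) - t))); last first.
  apply: (@le_trans _ _ (t ^+ m.+1 * f (n + m.+1)%N)).
    by apply: ler_wpM2l; rewrite ?exprn_ge0// /f le_max lexx orbT.
  by apply: ler_wpM2r => //; rewrite exprS ler_piMr// exprn_ile1// ltW.
rewrite lerBlDr; apply: le_trans (lerD (lexx _) ale).
rewrite (value01_split (orient01 c n) m.+1 t0' t1) (value01_split (orient01 b 0) m.+1 t0' t1).
rewrite (eq_series01 _ eqm) shift01_orient// addrCA lerD2l -mulrDr.
apply: ler_wpM2l; first exact: exprn_ge0.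
rewrite addrAC -addrA lerDl [in X in _ <= X](value01_rec _ t0' t1).
rewrite {1}/shift01 addn0 am subr_ge0 ler_peMr// lerDl.
exact: value01_ge0.
Qed.

(** Past the common prefix the tail of [c] is again oriented, hence worth at most [t]. The kneading
    sequence gets [t] from its digit 1 there and strictly more from a later 1. *)
Lemma value01_orient_lt t c b N k : 0 < t -> t < 1 -> ~ constant01 c ->
  avoids01 N c -> kneading_of R c b -> value01 t (orient01 b 0) <= t ->
  orient01 c k <> orient01 b 0 ->
  value01 t (orient01 c k) < value01 t (orient01 b 0).
Proof.
move=> t0 t1 nc cN bP ale ne; have t0' := ltW t0.
have [n [eqn dn an]] := orient01_lex cN bP ne.
rewrite (value01_split (orient01 c k) n t0' t1) (value01_split (orient01 b 0) n t0' t1).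
rewrite (eq_series01 _ eqn) shift01_orient// ltrD2l ltr_pM2l ?exprn_gt0//.
apply: le_lt_trans (value01_orient_le _ t0 t1 cN bP ale) _.
rewrite (value01_rec _ t0' t1) {1}/shift01 addn0 an ltr_pMr// ltrDl shift01D addn1.
have [m nm am] := kneading_orient_infinite n.+1 nc cN bP.
apply: lt_le_trans (series01_le (m - n) t0' (is_cvg_series01 t0' t1)).
have mn : (m - n = (m - n.+1).+1)%N by lia.
rewrite mn seriesSr ltr_wpDl//.
  by rewrite /series/= sumr_ge0// => j _; exact: term01_ge0.
by rewrite /term01 /shift01 subnKC// am mul1r exprn_gt0.
Qed.

(** Agreement on [n] digits leaves an error of at most [t ^+ n / (1 - t)], so an upper bound for the
    oriented tails passes to their limit. *)
Lemma value01_kneading_le t c b N x : 0 < t -> t < 1 -> avoids01 N c ->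
  kneading_of R c b -> (forall k, value01 t (orient01 c k) <= x) ->
  value01 t (orient01 b 0) <= x.
Proof.
move=> t0 t1 cN bP cx; have t0' := ltW t0; rewrite leNgt; apply/negP => Va.
have t1' : 0 < 1 - t by rewrite subr_gt0.
have e0 : 0 < (value01 t (orient01 b 0) - x) * (1 - t) by rewrite mulr_gt0// subr_gt0.
have [n tn] := expr_lt_eps t0' t1 e0; have [k kE] := kneading_approx n cN bP.
have := cx k; rewrite leNgt => /negP; apply.
move: tn; rewrite -ltr_pdivrMr//.
rewrite (value01_split (orient01 b 0) n t0' t1) (value01_split (orient01 c k) n t0' t1).
rewrite (eq_series01 _ kE); set A := value01 t (shift01 n (orient01 b 0)).
have B0 : 0 <= t ^+ n * value01 t (shift01 n (orient01 c k)).
  by rewrite mulr_ge0 ?exprn_ge0// value01_ge0.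
have : t ^+ n * A <= t ^+ n / (1 - t).
  apply: ler_wpM2l; rewrite ?exprn_ge0//; apply: le_trans (value01_le _ t0' t1) _.
  by rewrite ler_piMl// ?invr_ge0 ltW.
lra.
Qed.

End Kneading.

(** * The critical parameter *)

Section CriticalParameter.
Context {R : realType}.
Implicit Types (t u r x : R) (s a b c d : nat -> bool) (N k n : nat).

Lemma within_continuous_value01 s r : r < 1 ->
  {within `[0, r], continuous (fun t => value01 t s)}.
Proof.
move=> r1; apply/subspace_continuousP => t; rewrite /= in_itv/= => /andP[t0 tr].
apply/cvgrPdist_lt => eps eps0.
have r1' : 0 < (1 - r) ^+ 2 by rewrite exprn_gt0// subr_gt0.
near=> u; have : u \in `[0, r] by near: u; exact: withinT.
rewrite in_itv/= => /andP[u0 ur].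
apply: le_lt_trans (value01_lipschitz s t0 tr u0 ur r1) _.
rewrite ltr_pdivrMr//; near: u; apply: cvg_within.
by apply: (nbhsx_ballx t); rewrite mulr_gt0.
Unshelve. all: by end_near.
Qed.

Lemma bernoulli_ineq x n : 0 <= x -> x <= 1 -> 1 - n%:R * x <= (1 - x) ^+ n.
Proof.
move=> x0 x1; elim: n => [|n IH]; first by rewrite expr0; lra.
have x1' : 0 <= 1 - x by rewrite subr_ge0.
rewrite exprS; apply: le_trans (ler_wpM2l x1' IH); rewrite -natr1.
have : 0 <= n%:R * x * x by rewrite !mulr_ge0.
lra.
Qed.

Lemma value01_root s i j : (i < j)%N -> s i -> s j ->
  exists2 u : R, 0 <= u < 1 & value01 u s = 1.
Proof.
(* By Bernoulli's inequality this [x] gives [(1 - x) ^+ j.+1 >= 1/2], so the two digits 1 push the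
   value at [1 - x] to at least 1. The intermediate value theorem is applied below 1, where the
   series converges. *)
move=> ij si sj; pose x : R := (2 * j.+1%:R)^-1.
have j1 : (1 : R) <= j.+1%:R by rewrite ler1n.
have x0 : 0 < x by rewrite invr_gt0; lra.
have jx : j.+1%:R * x = 2^-1 by rewrite /x invfM mulrCA mulfV ?mulr1// gt_eqF//; lra.
have x1 : x <= 2^-1 by rewrite -jx ler_peMl// ltW.
have r0 : 0 <= 1 - x by lra.
have r1 : 1 - x < 1 by lra.
have p2 m : (m <= j)%N -> 2^-1 <= (1 - x) ^+ m.+1.
  move=> mj; apply: (@le_trans _ _ ((1 - x) ^+ j.+1)); last first.
    by apply: ler_wiXn2l => //; rewrite ltW.
  have x1' : x <= 1 by lra.
  by apply: le_trans (bernoulli_ineq j.+1 (ltW x0) x1'); rewrite jx; lra.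
have V1 : 1 <= value01 (1 - x) s.
  apply: le_trans (series01_le j.+1 r0 (is_cvg_series01 r0 r1)).
  rewrite seriesSr /term01 sj mul1r; apply: (@le_trans _ _ (2^-1 + 2^-1)); first by lra.
  apply: lerD; last exact: p2.
  rewrite /series/= (bigD1_seq i) ?mem_index_iota ?iota_uniq//= si mul1r.
  apply: ler_wpDr (p2 _ _); last exact: ltnW.
  by apply: sumr_ge0 => k _; exact: term01_ge0.
have V0 : value01 (0 : R) s = 0 by rewrite value01_rec// mul0r.
have [|u] := @IVT R (fun t => value01 t s) 0 (1 - x) 1 r0 (within_continuous_value01 r1).
  by rewrite V0 ge_min le_max ler01 V1 orbT.
rewrite in_itv/= => /andP[u0 ur] uE; exists u => //.
by rewrite u0 (le_lt_trans ur).
Qed.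

(** The defining set is inhabited, so [get] returns a genuine solution and not a default value. *)
Lemma tstar0P a : (forall m, exists2 n, (m <= n)%N & a n = true) ->
  0 <= (tstar0 a : R) <= 1 /\
  series (term01 (shift01 1 a) (tstar0 a)) @ \oo --> (1 : R).
Proof.
move=> ainf; rewrite /tstar0.
apply: (getPex (P := [set t | 0 <= t <= 1 /\
  series (fun k => (a k.+1)%:R * t ^+ k.+1) @ \oo --> (1 : R)])).
have [[//|i] _ ai] := ainf 1%N; have [[//|j] ij aj] := ainf i.+2.
have [u /andP[u0 u1] uE] := @value01_root (shift01 1 a) i j ij ai aj.
exists u; split; first by rewrite u0 ltW.
have := is_cvg_series01 (s := shift01 1 a) u0 u1.
by rewrite -/(value01 u (shift01 1 a)) uE.
Qed.

(** Dividing by [t] compares the value of the shifted sequence with 1; it increases strictly with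
    the parameter and equals 1 at [tstar0 a]. *)
Lemma value01_tstar0 a t : 0 < t -> t < 1 -> a 0%N = false ->
  (forall m, exists2 n, (m <= n)%N & a n = true) ->
  ((value01 t a < t) = (t < tstar0 a)) * ((value01 t a <= t) = (t <= tstar0 a)).
Proof.
move=> t0 t1 a0 ainf; have [/andP[T0 T1] cT] := tstar0P ainf.
have [[//|i] _ ai] := ainf 1%N.
have ct := is_cvg_series01 (s := shift01 1 a) (ltW t0) t1.
rewrite (value01_rec a (ltW t0) t1) a0 add0r ger_pMr// gtr_pMr//.
case: (ltgtP t (tstar0 a)) => [lt|gt|E].
- have := series01_lt_value (s := shift01 1 a) (ltW t0) lt ai ct cT.
  by rewrite -/(value01 _ _) => V; rewrite V ltW.
- have := series01_lt_value (s := shift01 1 a) T0 gt ai cT ct.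
  by rewrite -/(value01 _ _) => V; rewrite ltNge ltW//= leNgt V.
- have -> : value01 t (shift01 1 a) = 1 by rewrite E; apply/cvg_lim.
  by rewrite ltxx lexx.
Qed.

Lemma tstar_kneadingE b : tstar_kneading b = tstar0 (orient01 b 0) :> R.
Proof.
rewrite /tstar_kneading; have -> : orient01 b 0 = if b 0%N then compl01 b else b.
  by apply/funext => n; rewrite /orient01 /flip01 /shift01 /compl01; case: (b 0%N).
by case: (b 0%N).
Qed.

Lemma value01_orient_constant t c k : 0 <= t -> t < 1 -> constant01 c ->
  value01 t (orient01 c k) = 0.
Proof.
move=> t0 t1 cc; have E n : orient01 c k n = false.
  by rewrite /orient01 /flip01 /shift01 (cc k) (cc (k + n)%N) addbb.
have := value01_rec (orient01 c k) t0 t1.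
have -> : shift01 1 (orient01 c k) = orient01 c k by apply/funext => n; rewrite /shift01 !E.
rewrite E add0r => V; have : (1 - t) * value01 t (orient01 c k) = 0 by lra.
by move/eqP; rewrite mulf_eq0 gt_eqF ?subr_gt0//= => /eqP.
Qed.

Lemma value01_orient_tstar t c k : 0 < t -> t < 1 -> itinerary R c ->
  (t%:E <= tstar R c)%E -> value01 t (orient01 c k) <= t.
Proof.
move=> t0 t1 /itineraryP[N cN]; rewrite /tstar; case: asboolP => [cc _|nc].
  by rewrite value01_orient_constant// ltW.
have bP := getPex (@kneading_exists R c); set b := get _ in bP *.
have ainf m := kneading_orient_infinite m nc cN bP.
rewrite lee_fin tstar_kneadingE => tT; apply: value01_orient_le cN bP _ => //.
by rewrite value01_tstar0 ?orient01_0.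
Qed.

Lemma unique_address_tstar t c : 0 < t -> t < 1 -> itinerary R c ->
  (forall k, value01 t (orient01 c k) < t) <->
  (t%:E < tstar R c)%E \/
    t%:E = tstar R c /\ ~ exists k, kneading_of R c (shift01 k c).
Proof.
move=> t0 t1 /itineraryP[N cN]; rewrite /tstar; case: asboolP => [cc|nc].
  split=> [_|_ k]; first by left; rewrite ltry.
  by rewrite value01_orient_constant// ltW.
have bP := getPex (@kneading_exists R c); set b := get _ in bP *.
have ainf m := kneading_orient_infinite m nc cN bP.
have [aT aT'] := value01_tstar0 t0 t1 (orient01_0 b 0) ainf.
rewrite lte_fin tstar_kneadingE -aT; split=> [ct|[tT k|[[tT] nk] k]].
- have : value01 t (orient01 b 0) <= t.
    by apply: (value01_kneading_le t0 t1 cN bP) => // k; rewrite ltW.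
  rewrite le_eqVlt => /predU1P[Va|->]; last by left.
  right; have tT : t = tstar0 (orient01 b 0).
    by apply/eqP; rewrite eq_le -aT' Va lexx leNgt -aT Va ltxx.
  split=> [|[k kP]]; first by rewrite -tT.
  (* A kneading sequence inside the orbit dominates all oriented tails, so its value is at least
     that of [b], namely [t]. No identification of it with [b] or its complement is required. *)
  have := ct k; rewrite ltNge => /negP; apply; rewrite -[leLHS]Va.
  have aE : orient01 (shift01 k c) 0 = orient01 c k.
    by rewrite -{1}[shift01 k c]flip01F orient01_flip_shift addn0.
  apply: (value01_kneading_le t0 t1 cN bP) => // j; rewrite -aE.
  have [<-//|ne] := pselect (orient01 c j = orient01 (shift01 k c) 0).
  by apply/ltW/(value01_orient_lt t0 t1 nc cN kP _ ne); rewrite aE ltW.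
- have [->//|ne] := pselect (orient01 c k = orient01 b 0).
  exact: lt_trans (value01_orient_lt t0 t1 nc cN bP (ltW tT) ne) tT.
- have ale : value01 t (orient01 b 0) <= t by rewrite aT' tT.
  apply: lt_le_trans ale; apply: (value01_orient_lt t0 t1 nc cN bP).
    by rewrite aT' tT.
  (* Equality with the oriented [b] makes the tail a kneading sequence itself, since complementing
     preserves the distance to 1/2. *)
  move=> ca; apply: nk; exists k; split; first by apply: subset_closure; exists k.
  case: bP => _ bmin y /bmin; apply: le_trans.
  by rewrite -(binval_flip_half (c k) (shift01 k c)) -/(orient01 c k) ca binval_flip_half.
Qed.

End CriticalParameter.

(** * Unique addresses are itineraries *)

Section UniqueItinerary.
Context {R : realType}.

Lemma itinerary_of_unique (t : R) c : 2^-1 < t -> t < 1 ->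
  (forall k, value01 t (orient01 c k) < t) -> itinerary R c.
Proof.
move=> t2 t1 ct; have t0 : 0 < t by lra.
(* A block of 0 followed by [N] ones is worth at least [t * (t - t ^+ N.+1) / (1 - t)], which
   reaches [t] once [t ^+ N.+1 <= 2 * t - 1]. *)
apply/itineraryP; have [|N tN] := @expr_lt_eps R t (2 * t - 1) (ltW t0) t1; first by lra.
exists N => k; apply: contrapT => kN.
have := ct k; rewrite (value01_rec _ (ltW t0) t1) orient01_0 add0r gtr_pMr//.
have := @value01_ones_ge R t (shift01 1 (orient01 c k)) N (ltW t0) t1.
have ones i : (i < N)%N -> shift01 1 (orient01 c k) i.
  by move=> iN; apply/negPn/negP => /negbTE E; apply: kN; exists i.
move=> /(_ ones) H V1.
have : (1 - t) * value01 t (shift01 1 (orient01 c k)) < (1 - t) * 1.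
  by rewrite ltr_pM2l// subr_gt0.
have : t ^+ N.+1 <= t ^+ N by rewrite exprS ler_piMl ?exprn_ge0// ltW.
lra.
Qed.

End UniqueItinerary.

(** * Bernoulli convolutions *)

Section BernoulliConvolution.
Context {R : realType} (t : R) (nu : probability (measurableTypeR R) R).
Context (t0 : 0 < t) (t1 : t < 1) (nuP : is_bernoulli_convolution t nu).

Let mitv a b : measurable (`[a, b]%classic : set (measurableTypeR R)).
Proof. exact: measurable_itv. Qed.

Let nu_fin a b : nu `[a, b]%classic \is a fin_num.
Proof. exact: fin_num_measure. Qed.

(** The point 0 is its own preimage under one map and has none under the other, so its mass equals
    half of itself. *)
Lemma bernoulli_convolution_atom0 : nu `[0, 0]%classic = 0%E.
Proof.
have := nuP.2 `[0, 0]%classic (mitv 0 0).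
have -> : `[0, 1]%classic `&` ifs t false @^-1` `[0, 0]%classic = `[0, 0]%classic.
  apply/seteqP; split => y; rewrite /= !in_itv/= /ifs.
    by move=> [/andP[y0 y1] /andP[ty0 ty1]]; rewrite y0/= -(pmulr_rle0 _ t0).
  move=> /andP[y0 y1]; have -> : y = 0 by apply/eqP; rewrite eq_le y0 y1.
  by rewrite mulr0 lexx ler01.
have -> : `[0, 1]%classic `&` ifs t true @^-1` `[0, 0]%classic = set0.
  apply/seteqP; split => y //; rewrite /= !in_itv/= /ifs => -[/andP[y0 y1] /andP[_]].
  by apply/negP; rewrite -ltNge -addrA ltr_wpDl ?subr_gt0// mulr_ge0// ltW.
rewrite measure0 mule0 adde0 => /(_ _) H.
have {}H : nu `[0, 0]%classic = ((2^-1)%:E * nu `[0%R, 0%R]%classic)%E.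
  by apply: H => y; rewrite /= !in_itv/= => /andP[-> /le_trans]; apply.
move: H; rewrite -(fineK (nu_fin 0 0)) -EFinM => -[] H.
by congr (_%:E); lra.
Qed.

(** Outside the open overlap only one branch is undetermined: for [x >= t] the other preimage is the
    whole interval, for [x <= 1 - t] it is at most the null point 0. *)
Lemma bernoulli_convolution_le (x y : R) i : 0 <= y <= 1 -> x = ifs t i y ->
  (if i then t <= x else x <= 1 - t) ->
  nu `[0, x]%classic = ((2^-1)%:E * (i%:R%:E + nu `[0%R, y]%classic))%E.
Proof.
move=> /andP[y0 y1] xE xi.
have ty0 : 0 <= t * y by rewrite mulr_ge0// ltW.
have ty1 : t * y <= t by rewrite ler_piMr// ltW.
have x01 : `[0, x]%classic `<=` `[0, 1]%classic.
  move=> z; rewrite /= !in_itv/= => /andP[-> /le_trans]; apply.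
  by rewrite xE /ifs; case: (i); have := t1; lra.
rewrite (nuP.2 _ (mitv 0 x) x01).
case: i xE xi => /= xE xi.
  have -> : `[0, 1]%classic `&` ifs t false @^-1` `[0, x]%classic = `[0, 1]%classic.
    apply/setIidPl => z; rewrite /= !in_itv/= => /andP[z0 z1].
    have t0' := ltW t0; rewrite mulr_ge0//=; apply: le_trans xi.
    by rewrite ler_piMr.
  have -> : `[0, 1]%classic `&` ifs t true @^-1` `[0, x]%classic = `[0, y]%classic.
    apply/seteqP; split => z; rewrite /= !in_itv/= xE.
      by move=> [/andP[-> _] /andP[_]]; rewrite lerD2r lerD2r ler_pM2l.
    move=> /andP[z0 zy]; rewrite z0 (le_trans zy y1) lerD2r lerD2r ler_pM2l// zy andbT.
    by have := t1; have := mulr_ge0 (ltW t0) z0; split => //; lra.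
  by rewrite nuP.1 ge0_muleDr ?measure_ge0 ?lee01.
have -> : `[0, 1]%classic `&` ifs t false @^-1` `[0, x]%classic = `[0, y]%classic.
  apply/seteqP; split => z; rewrite /= !in_itv/= xE.
    by move=> [/andP[-> _] /andP[_]]; rewrite ler_pM2l.
  move=> /andP[z0 zy]; rewrite z0 (le_trans zy y1) ler_pM2l// zy andbT.
  by rewrite mulr_ge0// ltW.
have -> : `[0, 1]%classic `&` ifs t true @^-1` `[0, x]%classic =
    `[0, (x - (1 - t)) / t]%classic.
  apply/seteqP; split => z; rewrite /= !in_itv/= /ifs ler_pdivlMr//.
    by move=> [/andP[-> _] /andP[_]]; lra.
  move=> /andP[z0 zx]; have := mulr_ge0 (ltW t0) z0.
  have : z * t <= 1 * t by have := t1; lra.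
  rewrite ler_pM2r// => z1 tz0; rewrite z0 z1; have t1' := t1.
  by split => //; apply/andP; split; lra.
have -> : nu `[0, (x - (1 - t)) / t]%classic = 0%E.
  apply/eqP; rewrite eq_le measure_ge0 andbT -[leRHS]bernoulli_convolution_atom0.
  apply: le_measure; rewrite ?inE//; try exact: mitv.
  move=> z; rewrite /= !in_itv/= => /andP[-> /le_trans]; apply.
  by rewrite pmulr_lle0 ?invr_gt0// subr_le0.
by rewrite mule0 adde0 add0e.
Qed.

Lemma bernoulli_convolution_quantile b :
  (forall k, value01 t (orient01 b k) <= t) ->
  nu `[0, address_curve b t]%classic = (binval R b)%:E.
Proof.
move=> bt; pose X k := address_curve (shift01 k b) t.
pose G k := fine (nu `[0, X k]%classic).
have X01 k : 0 <= X k <= 1 by exact: address_curve_itv.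
have XE k : X k = ifs t (b k) (X k.+1).
  by rewrite /X address_curve_rec// shift01D addn1 {1}/shift01 addn0.
(* The bound on the oriented tail, scaled by [(1 - t) / t], says on which side of the overlap [X k]
   lies; a digit 1 passes through the complement. *)
have Xb k : if b k then t <= X k else X k <= 1 - t.
  have c0 : 0 < (1 - t) / t by rewrite divr_gt0// subr_gt0.
  have ct : (1 - t) / t * t = 1 - t by rewrite divfK// gt_eqF.
  have := bt k; rewrite -(ler_pM2l c0) ct /orient01; case bk : (b k); last by rewrite flip01F.
  have := value01_compl (shift01 k b) (ltW t0) t1.
  move=> /(congr1 (fun z => (1 - t) / t * z)).
  rewrite mulrDr -address_curveE -/(X k) mulrA ct divff ?gt_eqF ?subr_gt0//.
  have := t1; lra.
have GE k : G k = 2^-1 * ((b k)%:R + G k.+1).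
  by rewrite /G (bernoulli_convolution_le (X01 k.+1) (XE k) (Xb k))
    -(fineK (nu_fin 0 (X k.+1))).
have G01 k : 0 <= G k <= 1.
  rewrite /G fine_ge0//= -lee_fin fineK//; exact: probability_le1.
suff : G 0%N = binval R b.
  by move=> <-; rewrite /G fineK.
pose f k := `|G k - binval R (shift01 k b)|.
apply/eqP; rewrite -subr_eq0 -normr_le0 -[leRHS](mul0r (1 - 2^-1)^-1).
apply: (@contraction_bound R f 0 2^-1 1) => [||k|k]; try lra.
  have := G01 k; have := @binval_itv R (shift01 k b); rewrite /f ler_norml; lra.
exists k.+1; rewrite add0r /f GE binval_rec shift01D addn1 {1}/shift01 addn0 -mulrBr.
by rewrite opprD addrACA subrr add0r normrM ger0_norm ?invr_ge0.
Qed.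

End BernoulliConvolution.

(** * The set of unique addresses and the quantile identity *)

Unset Implicit Arguments.

Theorem theorem9 (R : realType) :
  (forall t : R, 2^-1 < t -> t < (Num.sqrt 5 - 1) / 2 ->
     unique_address t =
     [set address_curve c t | c in
        [set c : nat -> bool | itinerary R c /\
           ((t%:E < tstar R c)%E \/
            (t%:E = tstar R c /\
             ~ exists k : nat, kneading_of R c (shift01 k c)))]]) /\
  (forall (b : nat -> bool) (t : R)
          (nu : probability (measurableTypeR R) R),
     itinerary R b ->
     2^-1 <= t -> (t%:E <= tstar R b)%E -> t < 1 ->
     is_bernoulli_convolution t nu ->
     nu `[0, address_curve b t]%classic = (binval R b)%:E).
Proof.
split=> [t t2 tg|b t nu ib t2 tT t1 nuP].
  have t1 : t < 1.
    apply: lt_trans tg _; rewrite ltr_pdivrMr// mul1r ltrBlDr.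
    by rewrite -(ltr_pXn2r (n := 2))// ?nnegrE ?sqrtr_ge0// sqr_sqrtr//; lra.
  have t0 : 0 < t by lra.
  apply/seteqP; split => x.
    move=> /(unique_addressP _ (ltW t2) t1)[c -> ct].
    have ic := itinerary_of_unique t2 t1 ct.
    by exists c => //; split=> //; apply/unique_address_tstar.
  move=> [c [ic cT] <-]; apply/(unique_addressP _ (ltW t2) t1); exists c => //.
  exact/unique_address_tstar.
have t0 : 0 < t by lra.
apply: bernoulli_convolution_quantile => // k.
exact: value01_orient_tstar.
Qed.
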